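(* For every $\alpha>0$ there is a constant $C=C(\alpha)$ such that the following holds. If $D_0$ is an $n$-vertex digraph on vertex set $[n]$ with minimum semi-degree $\delta^0(D_0)\ge \alpha n$, then asymptotically almost surely (i.e., with probability tending to $1$ as $n\to\infty$) the digraph $D_0\cup D(n,C/n)$ contains every orientation of a cycle of every length between $2$ and $n$ (simultaneously).
   Context: A digraph is a loop-free set of vertices with a set of ordered pairs of distinct vertices (edges); between two vertices there is at most one edge in each direction. The minimum semi-degree $\delta^0(D)$ is the minimum over all vertices of all in- and outdegrees. $D(n,p)$ is the random digraph on $[n]$ in which each of the $n(n-1)$ possible directed edges is present independently with probability $p$; $D_0\cup D(n,p)$ is the digraph on $[n]$ whose edge set is the union of the two edge sets. An orientation of a cycle of length $\ell\ge 3$ is a digraph obtained from the undirected cycle on $\ell$ vertices by replacing each edge $uv$ by exactly one of the directed edges $uv$ or $vu$; a cycle of length $2$ consists of two vertices $u,v$ with both edges $uv$ and $vu$. ''Contains'' means contains a subdigraph isomorphic to it. *)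

(* Defs.v *)
From HB Require Import structures.
From mathcomp Require Import all_boot all_order all_algebra.
From mathcomp Require Import reals.

Set Implicit Arguments.
Unset Strict Implicit.
Unset Printing Implicit Defensive.

Import Order.TTheory GRing.Theory Num.Theory.

Local Open Scope ring_scope.

Definition loopless (V : finType) (E : {set V * V}) : bool :=
  [forall v, (v, v) \notin E].

Record digraph (V : finType) := Digraph {
  edges : {set V * V};
  edges_loopless : loopless edges
}.

HB.instance Definition _ (V : finType) := [isSub for @edges V].
HB.instance Definition _ (V : finType) := [Finite of digraph V by <:].

Definition edge (V : finType) (D : digraph V) : rel V :=
  fun u v => (u, v) \in edges D.

Definition outdeg (V : finType) (D : digraph V) (v : V) : nat :=
  #|[set w | edge D v w]|.

Definition indeg (V : finType) (D : digraph V) (v : V) : nat :=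
  #|[set w | edge D w v]|.

(* The default #|V| bounds every degree, so for nonempty V this is the true
   minimum. *)
Definition min_semidegree (V : finType) (D : digraph V) : nat :=
  \big[minn/#|V|]_(v : V) minn (outdeg D v) (indeg D v).

Lemma looplessU (V : finType) (D1 D2 : digraph V) :
  loopless (edges D1 :|: edges D2).
Proof.
apply/forallP => v; rewrite inE negb_or.
by rewrite (forallP (edges_loopless D1)) (forallP (edges_loopless D2)).
Qed.

Definition dunion (V : finType) (D1 D2 : digraph V) : digraph V :=
  Digraph (looplessU D1 D2).

(* Some (not necessarily induced) subdigraph of D is isomorphic to H. *)
Definition contains (V W : finType) (D : digraph V) (H : digraph W) : bool :=
  [exists f : {ffun W -> V},
     injectiveb f && [forall u, forall v, edge H u v ==> edge D (f u) (f v)]].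

(* Adjacency in the undirected cycle 0, 1, ..., l-1, 0; used for l >= 3. *)
Definition cycle_adj (l : nat) (u v : 'I_l) : bool :=
  (v == ordS u) || (u == ordS v).

Definition cycle_orientation (l : nat) (H : digraph 'I_l) : bool :=
  if l == 2%N then [forall u, forall v, edge H u v == (u != v)]
  else (3 <= l)%N &&
    [forall u, forall v,
       if cycle_adj u v then edge H u v (+) edge H v u else ~~ edge H u v].

Definition contains_all_cycle_orientations (n : nat) (D : digraph 'I_n) : bool :=
  [forall l : 'I_n.+1, (2 <= l)%N ==>
     [forall H : digraph 'I_l, cycle_orientation H ==> contains D H]].

(* The probability that D(n,p) equals D; see Dnp_mass_ge0 and Dnp_mass_sum1. *)
Definition Dnp_mass (R : realType) (n : nat) (p : R) (D : digraph 'I_n) : R :=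
  \prod_(e : 'I_n * 'I_n | e.1 != e.2) (if e \in edges D then p else 1 - p).

Definition Dnp_prob (R : realType) (n : nat) (p : R)
    (A : pred (digraph 'I_n)) : R :=
  \sum_(D : digraph 'I_n | A D) Dnp_mass p D.

Lemma Dnp_mass_ge0 (R : realType) (n : nat) (p : R) (D : digraph 'I_n) :
  0 <= p <= 1 -> 0 <= Dnp_mass p D.
Proof.
move=> /andP[p0 p1]; apply: prodr_ge0 => e _.
by case: ifP; rewrite ?subr_ge0.
Qed.

Lemma Dnp_mass_sum1 (R : realType) (n : nat) (p : R) :
  \sum_(D : digraph 'I_n) Dnp_mass p D = 1.
Proof.
pose F (e : 'I_n * 'I_n) : R := if e.1 != e.2 then p else 0.
pose G (e : 'I_n * 'I_n) : R := if e.1 != e.2 then 1 - p else 1.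
transitivity (\prod_e (F e + G e)); last first.
  by rewrite big1 // => e _; rewrite /F /G; case: ifP; rewrite ?add0r // addrC subrK.
rewrite bigA_distr (bigID (@loopless _)) /= [X in _ + X]big1 ?addr0; last first.
  move=> E; rewrite negb_forall => /existsP[v]; rewrite negbK => vE.
  by rewrite (bigD1 (v, v)) //= vE /F eqxx mul0r.
have massE (E : {set 'I_n * 'I_n}) : loopless E ->
    \prod_e (if e \in E then F e else G e) =
    \prod_(e | e.1 != e.2) (if e \in E then p else 1 - p).
  move=> /forallP h; rewrite [RHS]big_mkcond; apply: eq_bigr => -[u v] _ /=.
  rewrite /F /G /=; case: eqVneq => //= <-.
  by rewrite (negbTE (h u)).
rewrite (eq_bigr _ massE).
rewrite (reindex_omap (fun D : digraph 'I_n => edges D) insub) /=.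
  apply: eq_big => // D.
  by rewrite edges_loopless /= (valK D) eqxx.
by move=> E hE; rewrite insubT.
Qed.

(* Main.v *)
(* Only three features of the random digraph G are used: any two disjoint sets
   of k vertices span at least a constant fraction of the expected number of
   edges, any two disjoint sets of q << k vertices span an edge, and G has O(n)
   edges (plus one edge of G reversing an edge of D0, for the cycle of length 2).
   Each fails with exponentially small probability, by a Chernoff bound and a
   union bound over pairs of sets, so the word of the cycle can be chosen after G.

   Depth-first search finds a path with any prescribed orientations on all but
   O(q) vertices, and restricting the search to vertices with neighbours in
   given q-sets connects the ends of the path to prescribed vertices. This gives
   all cycles of length at most n - O(q).

   Longer cycles use an absorbing path with two kinds of gaps (y, z).
   "Centers" are left empty and have linearly many vertices fitting them by
   edges of D0. "Gadgets" are filled by a vertex w joined to y and z by edges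
   of G. They are chosen greedily against an exponential potential so that for
   every vertex v and every center i, linearly many gadgets have w fitting the
   center i and v fitting (y, z) by edges of D0: edges of G are needed since D0
   may be disconnected, and the counts are large because w, y and z can be found
   in three prescribed linear sets. After the depth-first search the remaining
   vertices v_i are assigned to distinct gadgets: v_i replaces w there, and w
   moves to the center i. *)
Require Import Defs.
From mathcomp Require Import all_boot all_order all_algebra.
From mathcomp Require Import reals sequences exp.
From mathcomp Require Import zify ring lra.

Set Implicit Arguments.
Unset Strict Implicit.
Unset Printing Implicit Defensive.

(** * Oriented paths by depth-first search *)

Lemma subset_of_card (T : finType) (A : {set T}) (k : nat) :
  k <= #|A| -> exists2 B : {set T}, B \subset A & #|B| = k.
Proof.
move=> kA; exists [set x in take k (enum A)].
  by apply/subsetP => x; rewrite inE => /mem_take; rewrite mem_enum.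
rewrite cardsE (card_uniqP _) ?take_uniq ?enum_uniq // size_takel //.
by rewrite -cardE.
Qed.

Lemma two_disjoint_subsets (T : finType) (A B : {set T}) (k : nat) :
    2 * k <= #|A| -> 2 * k <= #|B| ->
  exists A' B' : {set T}, [/\ A' \subset A, B' \subset B, #|A'| = k,
    #|B'| = k & [disjoint A' & B']].
Proof.
move=> kA kB.
have [|A' sA cA] := @subset_of_card _ A k; first lia.
have [|B' sB cB] := @subset_of_card _ (B :\: A') k.
  by have := cardsID A' B; have := subset_leq_card (subsetIr B A'); lia.
exists A', B'; split=> //; first exact: subset_trans sB (subsetDl _ _).
rewrite disjoint_sym; apply: disjointWl sB _.
by rewrite -setI_eq0 setIC setDE setIC -setIA [~: _ :&: _]setIC setICr setI0.
Qed.

Section OrientedPaths.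
Variable V : finType.
Implicit Types (r : rel V) (w : nat -> bool) (s : seq V) (A B U X : {set V}).

Definition dir r (b : bool) : rel V := fun x y => if b then r x y else r y x.

Lemma dirN r b x y : dir r (~~ b) x y = dir r b y x.
Proof. by case: b. Qed.

(* Edge [i] of the path is oriented by [w (k + i)]. *)
Fixpoint wpath r w (k : nat) (x : V) s : bool :=
  if s is y :: s' then dir r (w k) x y && wpath r w k.+1 y s' else true.

Lemma wpath_cat r w k x s1 s2 :
  wpath r w k x (s1 ++ s2) =
  wpath r w k x s1 && wpath r w (k + size s1) (last x s1) s2.
Proof.
elim: s1 k x => [|y s1 IH] k x /=; first by rewrite addn0.
by rewrite IH andbA addSnnS.
Qed.

Lemma wpath_rcons r w k x s y :
  wpath r w k x (rcons s y) =
  wpath r w k x s && dir r (w (k + size s)) (last x s) y.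
Proof. by rewrite -cats1 wpath_cat /= andbT. Qed.

Lemma wpath_shift r w k j x s :
  wpath r (fun i => w (k + i)) j x s = wpath r w (k + j) x s.
Proof. by elim: s j x => //= y s IH j x; rewrite IH addnS. Qed.

Lemma wpath_nth r w k x s x0 i : wpath r w k x s -> i < size s ->
  dir r (w (k + i)) (nth x0 (x :: s) i) (nth x0 s i).
Proof.
elim: s k x i => // y s IH k x [|i] /= /andP[xy ys]; first by rewrite addn0.
by rewrite ltnS -addSnnS => /(IH _ _ _ ys).
Qed.

Definition opath r w s : bool := if s is x :: s' then wpath r w 0 x s' else true.

Lemma opath_rcons r w x s y :
  opath r w (rcons (rcons s x) y) =
  opath r w (rcons s x) && dir r (w (size s)) x y.
Proof.
case: s => [|z s] /=; first by rewrite andbT.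
by rewrite wpath_rcons last_rcons size_rcons.
Qed.

Definition joined r k : Prop := forall A B, [disjoint A & B] ->
  k <= #|A| -> k <= #|B| -> exists a b, [/\ a \in A, b \in B & r a b].

Lemma joined_dir r k : joined r k -> forall b, joined (dir r b) k.
Proof.
move=> H [] A B //= dAB kA kB; first exact: H.
rewrite disjoint_sym in dAB.
by have [b [a [? ? ?]]] := H B A dAB kB kA; exists a, b.
Qed.

Lemma joined_gt0 r k : joined r k -> 0 < k.
Proof.
move=> H; rewrite lt0n; apply/eqP => k0; subst k.
have [|||a [b []]] := H set0 set0; rewrite ?inE //.
by rewrite -setI_eq0 setI0.
Qed.

(* Depth-first search with [X] the unvisited vertices and [Dd b] the dead
   vertices that were looking for a neighbour in direction [b]; since no edge
   of that direction leaves [Dd b] for [X], each [Dd b] stays below [k]. *)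
Lemma dfs_step r k w U len : joined r k -> len + 3 * k <= #|U| ->
  forall N s X (Dd : bool -> {set V}), 2 * #|X| + size s <= N ->
    uniq s -> opath r w s -> {subset s <= U} -> X \subset U ->
    (forall x, x \in s -> x \notin X) ->
    (forall b x, x \in Dd b -> x \notin X /\ x \notin s) ->
    (forall b x y, x \in Dd b -> y \in X -> ~~ dir r b x y) ->
    (forall b, #|Dd b| < k) ->
    #|U| <= #|X| + size s + #|Dd true| + #|Dd false| -> size s <= len ->
  exists s', [/\ size s' = len, uniq s', {subset s' <= U} & opath r w s'].
Proof.
move=> J lenU; elim=> [|N IH] s X Dd leN us ps sU XU sX DX nD kD cU sl.
  by have := joined_gt0 J; have := kD true; have := kD false; lia.
have [sz|sz] := eqVneq (size s) len; first by exists s.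
have k0 := joined_gt0 J.
have kX : k <= #|X| by have := kD true; have := kD false; lia.
case/lastP: s leN us ps sU sX DX cU sl sz => [|s y] leN us ps sU sX DX cU sl sz.
  have /card_gt0P[x xX] : 0 < #|X| by lia.
  apply: (IH [:: x] (X :\ x) Dd) => //=.
  - by have := cardsD1 x X; rewrite xX /=; move: leN => /=; lia.
  - by move=> z; rewrite inE => /eqP->; apply: (subsetP XU).
  - exact: subset_trans (subsetDl _ _) XU.
  - by move=> z; rewrite inE => /eqP->; rewrite !inE eqxx.
  - move=> b z zD; have [zX _] := DX b z zD; rewrite !inE (negbTE zX) andbF.
    by split=> //; apply: contraNneq zX => ->.
  - by move=> b z t zD; rewrite !inE => /andP[_ tX]; apply: nD zD tX.
  - by have := cardsD1 x X; rewrite xX /=; move: cU => /=; lia.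
  - by move: sl sz => /=; lia.
rewrite size_rcons in leN cU sl sz.
have yX : y \notin X by apply: sX; rewrite mem_rcons mem_head.
have [/existsP[x /andP[xX xy]]|/existsPn noX] :=
  boolP [exists x, (x \in X) && dir r (w (size s)) y x].
  apply: (IH (rcons (rcons s y) x) (X :\ x) Dd) => //=.
  - by have := cardsD1 x X; rewrite xX /= !size_rcons; lia.
  - by rewrite rcons_uniq us andbT; apply: contraL xX => /sX.
  - by rewrite opath_rcons ps.
  - move=> z; rewrite mem_rcons inE => /orP[/eqP->|/sU //].
    exact: (subsetP XU).
  - exact: subset_trans (subsetDl _ _) XU.
  - move=> z; rewrite mem_rcons !inE => /orP[/eqP->|/sX zX]; first by rewrite eqxx.
    by rewrite (negbTE zX) andbF.
  - move=> b z zD; have [zX zs] := DX b z zD.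
    rewrite !inE (negbTE zX) andbF mem_rcons inE negb_or zs andbT.
    by split=> //; apply: contraNneq zX => ->.
  - by move=> b z t zD; rewrite !inE => /andP[_ tX]; apply: nD zD tX.
  - by have := cardsD1 x X; rewrite xX /= !size_rcons; lia.
  - by rewrite !size_rcons; lia.
pose b0 := w (size s).
pose D' b := if b == b0 then y |: Dd b else Dd b.
have yD b : y \notin Dd b.
  by apply/negP => /DX[_]; rewrite mem_rcons mem_head.
have D'P b x : x \in D' b -> x \in Dd b \/ (b = b0 /\ x = y).
  rewrite /D'; case: eqP => [->|_]; last by left.
  by rewrite !inE => /orP[/eqP->|]; auto.
have D'X b x : x \in D' b -> x \notin X.
  by move=> /D'P[/DX[]|[_ ->]].
have D'n b x z : x \in D' b -> z \in X -> ~~ dir r b x z.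
  move=> /D'P[/nD h|[-> ->]] zX; first exact: h.
  by have := noX z; rewrite zX.
rewrite rcons_uniq in us; case/andP: us => ys us.
apply: (IH s X D') => //.
- by lia.
- by case/lastP: {+}s ps => [//|t z]; rewrite opath_rcons => /andP[].
- by move=> z zs; apply: sU; rewrite mem_rcons inE zs orbT.
- by move=> z zs; apply: sX; rewrite mem_rcons inE zs orbT.
- move=> b z zD; split; first exact: D'X zD.
  have [/DX[_]|[_ ->] //] := D'P _ _ zD.
  by rewrite mem_rcons inE negb_or => /andP[].
- move=> b; rewrite ltnNge; apply/negP => kD'.
  have dX : [disjoint D' b & X].
    by rewrite disjoint_subset; apply/subsetP => z; rewrite inE; apply: D'X.
  have [z [t [zD tX zt]]] := joined_dir J b dX kD' kX.
  by have := D'n _ _ _ zD tX; rewrite zt.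
- have c b : #|D' b| = (b == b0) + #|Dd b|.
    by rewrite /D'; case: eqP => // _; rewrite cardsU1 yD.
  by rewrite !c; case: (b0); rewrite /=; lia.
- by lia.
Qed.

Lemma long_path r k w U len : joined r k -> len + 3 * k <= #|U| ->
  exists s, [/\ size s = len, uniq s, {subset s <= U} & opath r w s].
Proof.
move=> J lenU; have k0 := joined_gt0 J.
apply: (dfs_step (X := U) (s := [::]) (Dd := fun=> set0) J lenU (leqnn _)) => //.
- by move=> b x; rewrite inE.
- by move=> b x y; rewrite inE.
- by move=> b; rewrite cards0.
- by rewrite /=; lia.
Qed.

Lemma few_unjoined r k A U : joined r k -> #|A| = k -> [disjoint A & U] ->
  forall b, #|[set x in U | [forall a in A, ~~ dir r b a x]]| < k.
Proof.
move=> J cA dAU b; rewrite ltnNge; apply/negP => kB.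
have [|a [x [aA xB ax]]] := joined_dir J b _ (eq_leq (esym cA)) kB.
  by apply: disjointWr dAU; apply/subsetP => x; rewrite inE => /andP[].
by move: xB; rewrite inE => /andP[_ /forallP/(_ a)]; rewrite aA ax.
Qed.

Lemma connecting_path r k w x y (W : {set V}) len : joined r k ->
    2 * k <= #|[set a in W | dir r (w 0) x a]| ->
    2 * k <= #|[set b in W | dir r (w len.+2) b y]| ->
    len + 8 * k <= #|W| ->
  exists s, [/\ size s = len.+2, uniq s, {subset s <= W} &
    wpath r w 0 x (rcons s y)].
Proof.
move=> J kx ky lenW.
have [A [B [sA sB cA cB dAB]]] := two_disjoint_subsets kx ky.
have AP a : a \in A -> a \in W /\ dir r (w 0) x a.
  by move=> /(subsetP sA); rewrite inE => /andP[].
have BP b : b \in B -> b \in W /\ dir r (w len.+2) b y.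
  by move=> /(subsetP sB); rewrite inE => /andP[].
case: len lenW ky sB BP => [|len] lenW ky sB BP.
  have [||a [b [aA bB ab]]] := joined_dir J (w 1) dAB; rewrite ?cA ?cB //.
  have [[aW xa] [bW yb]] := (AP _ aA, BP _ bB).
  exists [:: a; b]; split; rewrite //= ?xa ?ab ?yb //.
    rewrite inE andbT; apply: contraTneq aA => ->.
    by rewrite (disjointFl dAB bB).
  by move=> z; rewrite !inE => /orP[/eqP->|/eqP->].
pose W0 := W :\: A :\: B.
have dA : [disjoint A & W0].
  by rewrite -setI_eq0; apply/eqP/setP=> z; rewrite !inE; case: (z \in A); rewrite ?andbF.
have dB : [disjoint B & W0].
  by rewrite -setI_eq0; apply/eqP/setP=> z; rewrite !inE; case: (z \in B).
set w1 := w 1; set w2 := w len.+2.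
pose U := [set z in W0 | [exists a in A, dir r w1 a z] && [exists b in B, dir r w2 z b]].
have cW0 : #|W| <= #|W0| + 2 * k.
  have := cardsID B (W :\: A); have := cardsID A W.
  have := subset_leq_card (subsetIr (W :\: A) B).
  have := subset_leq_card (subsetIr W A); rewrite cA cB -/W0; lia.
have cU : #|W0| <= #|U| + 2 * k.
  have b1 := few_unjoined J cA dA w1; have b2 := few_unjoined J cB dB (~~ w2).
  have : W0 \subset U :|: ([set z in W0 | [forall a in A, ~~ dir r w1 a z]] :|:
             [set z in W0 | [forall a in B, ~~ dir r (~~ w2) a z]]).
    apply/subsetP => z zW.
    have zE (P : pred V) : (z \in [set x in W0 | P x]) = P z by rewrite in_set zW.
    rewrite 2!in_setU !zE.
    rewrite -[X in X && _]negbK -[X in _ && X]negbK !negb_exists.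
    rewrite (eq_forallb (P2 := fun a => (a \in A) ==> ~~ dir r w1 a z)); last first.
      by move=> a; rewrite negb_and implybE.
    rewrite (eq_forallb (P1 := fun a => ~~ ((a \in B) && _))
      (P2 := fun a => (a \in B) ==> ~~ dir r (~~ w2) a z)); last first.
      by move=> a; rewrite negb_and implybE dirN.
    by do 2 case: [forall _, _].
  move/subset_leq_card; rewrite !cardsU; lia.
have [s [ss us sU ps]] : exists s, [/\ size s = len.+1, uniq s, {subset s <= U}
    & opath r (fun i => w (2 + i)) s].
  by apply: (long_path _ J); lia.
case: s ss us sU ps => // q s [ss] us sU /= ps.
have UW z : z \in U -> z \in W /\ (z \notin A /\ z \notin B).
  by rewrite !inE => /andP[/and3P[-> -> ->]].
have qU : q \in U by apply: sU; rewrite mem_head.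
have lU : last q s \in U by apply: sU; rewrite mem_last.
have [a aA aq] : exists2 a, a \in A & dir r w1 a q.
  by move: qU; rewrite inE => /and3P[_ /existsP[a /andP[? ?]] _]; exists a.
have [b bB bq] : exists2 b, b \in B & dir r w2 (last q s) b.
  by move: lU; rewrite inE => /and3P[_ _ /existsP[b /andP[? ?]]]; exists b.
have [[aW xa] [bW yb]] := (AP _ aA, BP _ bB).
exists (a :: q :: rcons s b); split.
- by rewrite /= size_rcons ss.
- rewrite -rcons_cons -rcons_cons rcons_uniq cons_uniq us andbT inE negb_or.
  have nab: b != a by apply: contraTneq aA => <-; rewrite (disjointFl dAB bB).
  rewrite nab; apply/andP; split; first by apply: contraL bB => /sU/UW[_ []].
  by apply: contraL aA => /sU/UW[_ []].
- move=> z; rewrite -rcons_cons -rcons_cons mem_rcons !inE.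
  case/or4P=> [/eqP->|/eqP->|/eqP->|zs] //; first by case: (UW _ qU).
  by case: (UW z) => //; apply: sU; rewrite inE zs orbT.
- rewrite /= xa aq /= !wpath_rcons last_rcons size_rcons ss /= !addSn add0n yb.
  by rewrite andbT bq andbT; move: ps; rewrite wpath_shift.
Qed.

End OrientedPaths.

Section Cycles.
Variable V : finType.

Definition cword (l : nat) (H : digraph 'I_l) (i : nat) : bool :=
  if insub i is Some u then edge H u (ordS u) else false.

Lemma contains_closed_walk (D : digraph V) l (H : digraph 'I_l) x s :
    3 <= l -> cycle_orientation H -> size s = l.-1 -> uniq (x :: s) ->
    wpath (edge D) (cword H) 0 x (rcons s x) -> contains D H.
Proof.
move=> l3 oH ss us ps; apply/existsP; exists [ffun u : 'I_l => nth x (x :: s) u].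
have sxs : size (x :: s) = l by rewrite /= ss; lia.
apply/andP; split.
  apply/injectiveP => u v; rewrite !ffunE => /eqP.
  by rewrite nth_uniq ?sxs // => /eqP/val_inj.
have step u : dir (edge D) (edge H u (ordS u)) (nth x (x :: s) u)
    (nth x (x :: s) (ordS u)).
  have us' : u < size (rcons s x) by rewrite size_rcons ss; have := ltn_ord u; lia.
  have := wpath_nth x ps us'; rewrite add0n /cword valK -rcons_cons !nth_rcons.
  rewrite sxs ltn_ord ss [nat_of_ord (ordS u)]/=.
  have [ul|ul] := ltnP u l.-1.
    by rewrite modn_small //; have := ltn_ord u; lia.
  have -> : u = l.-1 :> nat by have := ltn_ord u; lia.
  by rewrite eqxx prednK ?modnn //; lia.
apply/forallP => u; apply/forallP => v; apply/implyP => uv; rewrite !ffunE.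
move: oH; rewrite /cycle_orientation; case: eqP => [le2|_]; first by lia.
rewrite l3 /= => /forallP/(_ u)/forallP/(_ v).
case: ifP => [|_]; last by rewrite uv.
case/orP=> /eqP def.
  by move=> _; have := step u; rewrite -def uv.
by rewrite uv /= => nvu; have := step v; rewrite -def (negbTE nvu).
Qed.

Lemma contains_2cycle (D : digraph V) (H : digraph 'I_2) u v :
  edge D u v -> edge D v u -> contains D H.
Proof.
move=> uv vu; apply/existsP; exists [ffun i : 'I_2 => if i == ord0 then u else v].
have irrD x : edge D x x = false.
  by apply: negbTE; apply: (forallP (edges_loopless D)).
have irrH x : edge H x x = false.
  by apply: negbTE; apply: (forallP (edges_loopless H)).
have nuv : u == v = false by apply: contraTF uv => /eqP->; rewrite irrD.
have two (i j : 'I_2) : i != ord0 -> j != ord0 -> i = j.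
  by move: i j => [[|[]]] // ? [[|[]]] // ? _ _; apply: val_inj.
apply/andP; split.
  apply/injectiveP => i j; rewrite !ffunE.
  have [->|i0] := eqVneq i ord0; have [->|j0] := eqVneq j ord0; move=> // /eqP.
  - by rewrite nuv.
  - by rewrite eq_sym nuv.
  - by move=> _; apply: two.
apply/forallP => i; apply/forallP => j; apply/implyP => ij; rewrite !ffunE.
have : i != j by apply: contraTneq ij => ->; rewrite irrH.
have [->|i0] := eqVneq i ord0; have [_|j0] := eqVneq j ord0; rewrite ?eqxx //.
by rewrite (two _ _ i0 j0) eqxx.
Qed.

Lemma short_cycle (r : rel V) k w l (x : V) : joined r k -> irreflexive r ->
    (forall b, 2 * k <= #|[set y | dir r b x y]|) ->
    3 <= l -> l + 8 * k <= #|V| ->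
  exists s, [/\ size s = l.-1, uniq (x :: s) & wpath r w 0 x (rcons s x)].
Proof.
move=> J irr deg l3 lV.
have dirx b : dir r b x x = false by case: b; apply: irr.
have deg' b : 2 * k <= #|[set y in [set~ x] | dir r b x y]|.
  rewrite (leq_trans (deg b)) // subset_leq_card //; apply/subsetP => y.
  by rewrite !inE => xy; rewrite xy andbT; apply: contraTneq xy => ->; rewrite dirx.
have [|||s [ss us sW ps]] := @connecting_path V r k w x x [set~ x] (l - 3) J.
- exact: deg'.
- rewrite (leq_trans (deg' (~~ w (l - 3).+2))) // subset_leq_card //.
  by apply/subsetP => y; rewrite !inE dirN.
- by rewrite cardsC1; lia.
exists s; split=> //; first by rewrite ss; lia.
by rewrite /= us andbT; apply/negP => /sW; rewrite !inE eqxx.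
Qed.

End Cycles.

(** * Centers and gadgets *)

Lemma card_setI_sum (T : finType) (A : {set T}) (P : pred T) :
  #|[set x in A | P x]| = \sum_(x in A) P x.
Proof.
rewrite -sum1_card big_mkcond [RHS]big_mkcond; apply: eq_bigr => x _.
by rewrite !inE; case: (x \in A).
Qed.

Lemma card_double_count (S T : finType) (A : {set S}) (B : {set T})
    (P : S -> T -> bool) :
  \sum_(x in A) #|[set y in B | P x y]| = \sum_(y in B) #|[set x in A | P x y]|.
Proof.
rewrite (eq_bigr _ (fun x _ => card_setI_sum _ _)) exchange_big.
by apply: eq_bigr => y _; rewrite card_setI_sum.
Qed.

Lemma card_prod_sum (S T : finType) (X : {set S * T}) :
  #|X| = \sum_x #|[set y | (x, y) \in X]|.
Proof.
transitivity (\sum_(x in [set: S]) #|[set y in [set: T] | (x, y) \in X]|).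
  rewrite (eq_bigr _ (fun x _ => card_setI_sum _ _)) pair_big /=.
  rewrite -sum1_card big_mkcond; apply: eq_big => [[x y]|[x y] _] /=.
    by rewrite !inE.
  by case: ((x, y) \in X).
apply: eq_big => x; first by rewrite inE.
by move=> _; apply: eq_card => y; rewrite !inE.
Qed.

Section Centers.
Variable V : finType.
Implicit Types (r : rel V) (b : bool) (U A B S : {set V}) (p : V * V).

Definition nbr r b x : {set V} := [set y | dir r b x y].

Definition fit r b1 b2 p x : bool := dir r b1 p.1 x && dir r b2 x p.2.

Definition flat (ps : seq (V * V)) : seq V :=
  flatten [seq [:: p.1; p.2] | p <- ps].

Lemma popular_gap r d s b1 b2 U : 0 < #|V| -> (forall b x, d <= #|nbr r b x|) ->
    2 * (#|U| + 1) <= d -> 2 * (#|V| * s) <= d * d ->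
  exists y z, [/\ y \notin U, z \notin U, y != z &
    s <= #|[set x | fit r b1 b2 (y, z) x]|].
Proof.
move=> V0 deg dU ds.
have dV : d <= #|V|.
  by have /card_gt0P[x _] := V0; apply: leq_trans (deg true x) (max_card _).
have cV := cardsC U.
have [y yU] : exists y, y \notin U.
  have : 0 < #|~: U| by have := max_card (mem U); lia.
  by case/card_gt0P=> y; rewrite inE; exists y.
pose A := nbr r b1 y; pose Z := ~: (y |: U).
have cZ : #|Z| + #|U| + 1 = #|V|.
  by have := cardsC (y |: U); rewrite cardsU1 yU /Z; lia.
have Zd x : d <= #|[set z in Z | dir r b2 x z]| + #|U| + 1.
  apply: leq_trans (deg b2 x) _.
  have : nbr r b2 x \subset [set z in Z | dir r b2 x z] :|: (y |: U).
    by apply/subsetP => z; rewrite !inE => ->; rewrite andbT orNb.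
  by move/subset_leq_card/leq_trans; apply; rewrite cardsU cardsU1 yU; lia.
case: (pickP (fun z => (z \in Z) && (s <= #|[set x in A | dir r b2 x z]|))).
  move=> z /andP[]; rewrite !inE negb_or => /andP[zy zU] sz.
  exists y, z; split; rewrite // 1?eq_sym //.
  rewrite (leq_trans sz) // subset_leq_card //.
  by apply/subsetP => x; rewrite !inE.
move=> noz; exfalso.
have := card_double_count A Z (fun x z => dir r b2 x z).
have lb : #|A| * (d - #|U| - 1) <= \sum_(x in A) #|[set z in Z | dir r b2 x z]|.
  rewrite -sum_nat_const; apply: leq_sum => x _; have := Zd x; lia.
have ub : \sum_(z in Z) #|[set x in A | dir r b2 x z]| + #|Z| <= #|Z| * s.
  rewrite -sum_nat_const -sum1_card -big_split /=; apply: leq_sum => z zZ.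
  by have := noz z; rewrite zZ /=; lia.
have dA : d <= #|A| by apply: deg.
have sV : #|Z| * s <= #|V| * s by rewrite leq_mul2r; lia.
have : d * d <= 2 * (#|A| * (d - #|U| - 1)).
  rewrite -[X in _ <= X]mulnCA leq_mul //; lia.
lia.
Qed.

Lemma centers r d s u : 0 < #|V| -> (forall b x, d <= #|nbr r b x|) ->
    2 * (u + 1) <= d -> 2 * (#|V| * s) <= d * d ->
  forall m (w1 w2 : nat -> bool) U x0, #|U| + 2 * m <= u ->
  exists ps, [/\ size ps = m, uniq (flat ps), {in flat ps, forall x, x \notin U} &
    forall j, j < m -> s <= #|[set x | fit r (w1 j) (w2 j) (nth (x0, x0) ps j) x]|].
Proof.
move=> V0 deg du ds; elim=> [|m IH] w1 w2 U x0 Um; first by exists [::].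
have [|y [z [yU zU yz sz]]] := @popular_gap r d s (w1 0) (w2 0) U V0 deg _ ds; first lia.
have cU : #|y |: (z |: U)| = #|U| + 2.
  by rewrite !cardsU1 !inE (negbTE yz) (negbTE yU) zU; lia.
have [|ps [sp up dp hp]] :=
  IH (fun j => w1 j.+1) (fun j => w2 j.+1) (y |: (z |: U)) x0; first lia.
exists ((y, z) :: ps); split.
- by rewrite /= sp.
- rewrite /flat /= -/(flat ps) up inE negb_or yz !andbT /=.
  by apply/andP; split; apply/negP => /dp; rewrite !inE eqxx ?orbT.
- move=> x; rewrite /flat /= -/(flat ps) !inE => /or3P[/eqP->|/eqP->|/dp] //.
  by rewrite !inE !negb_or => /and3P[].
- by case=> [|j] //= /hp.
Qed.

End Centers.

Section Gadgets.
Variable V : finType.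
Implicit Types (r : rel V) (b : bool) (U A B S : {set V}) (p : V * V).

Definition dense r k h : Prop := forall A B, [disjoint A & B] ->
  #|A| = k -> #|B| = k -> k * h <= \sum_(a in A) #|[set b in B | r a b]|.

Lemma dense_dir r k h : dense r k h -> forall b, dense (dir r b) k h.
Proof.
move=> H [] A B //= dAB kA kB; first exact: H.
by rewrite disjoint_sym in dAB; rewrite card_double_count; apply: H.
Qed.

Lemma few_poor r k h A U b : 0 < k -> dense r k h -> #|A| = k ->
  [disjoint A & U] -> #|[set x in U | #|[set a in A | dir r b a x]| < h]| < k.
Proof.
move=> k0 H kA dAU; rewrite ltnNge; apply/negP => /subset_of_card[B sB kB].
have dAB : [disjoint A & B].
  by apply: disjointWr (subset_trans sB _) dAU; apply/subsetP=> x; rewrite inE => /andP[].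
have := dense_dir H b dAB kA kB; rewrite card_double_count leqNgt.
move/negP; apply; rewrite -kB -sum_nat_const.
rewrite [X in X < _](big_setID B) /= setIid setDv big_set0 addn0.
have /card_gt0P[x xB] : 0 < #|B| by lia.
have Bh y : y \in B -> #|[set a in A | dir r b a y]| < h.
  by move=> /(subsetP sB); rewrite inE => /andP[].
rewrite (bigD1 x) //= [X in _ < X](bigD1 x) //= -addSn leq_add ?Bh //.
by apply: leq_sum => y /andP[/Bh/ltnW].
Qed.

Definition low_degree r D x : bool := (#|nbr r true x| <= D) && (#|nbr r false x| <= D).

Lemma few_high_degree r D k M : \sum_x #|nbr r true x| <= M ->
  2 * M < k * D.+1 -> #|[set x | ~~ low_degree r D x]| < k.
Proof.
move=> hM MkD; set Hi := [set x | _].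
have inM : \sum_x #|nbr r false x| <= M.
  apply: leq_trans hM; rewrite eq_leq //.
  have nE b x : #|nbr r b x| = \sum_y dir r b x y.
    rewrite -sum1_card big_mkcond; apply: eq_bigr => y _.
    by rewrite inE; case: dir.
  rewrite (eq_bigr _ (fun x _ => nE false x)) exchange_big /=.
  by apply: eq_bigr => x _; rewrite nE.
have : #|Hi| * D.+1 <= 2 * M.
  rewrite -sum_nat_const (leq_trans (_ : _ <= \sum_x (#|nbr r true x| + #|nbr r false x|))) //.
    rewrite big_mkcond leq_sum // => x _; case: ifP => //.
    by rewrite inE negb_and -!ltnNge; lia.
  by rewrite big_split /=; lia.
by move=> h; rewrite ltnNge; apply/negP => kH; have := leq_mul kH (leqnn D.+1); lia.
Qed.

Lemma potential_drop (K a b c : nat) :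
  b <= K * c -> a + c = 2 * b -> K * a <= (2 * K - 1) * b.
Proof.
move=> bc /(congr1 (muln K)).
by rewrite mulnDr mulnCA mulnBl mul1n -mulnA; lia.
Qed.

Section GadgetSelection.
Variables (r0 r : rel V) (k h D M u K0 : nat) (I : finType) (S : I -> {set V}).
Hypotheses (k0 : 0 < k) (h0 : 0 < h) (Hdense : dense r k h).
Hypotheses (HM : \sum_x #|nbr r true x| <= M) (HMD : 2 * M < k * D.+1).
Hypothesis Hdeg : forall b x, u + 2 * k <= #|nbr r0 b x|.
Hypothesis HS : forall i, u + 6 * k <= #|S i|.
Hypothesis HK0 : #|V| * (D * D) <= K0 * (k * (h * h)).

Definition candidates b1 b2 U : {set V * (V * V)} :=
  [set t | [&& low_degree r D t.1, t.1 \notin U, t.2.1 \notin U, t.2.2 \notin U,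
     uniq [:: t.2.1; t.1; t.2.2] & fit r b1 b2 t.2 t.1]].

(* [vi = (v, i)]: the vertex [x] may leave the gap [p] to [v] and move to the
   center [i]. *)
Definition serves b1 b2 x p (vi : V * I) : bool := (x \in S vi.2) && fit r0 b1 b2 p vi.1.

Lemma card_candidates b1 b2 U : #|candidates b1 b2 U| <= #|V| * (D * D).
Proof.
rewrite card_prod_sum -sum_nat_const; apply: leq_sum => x _.
have [lx|nlx] := boolP (low_degree r D x); last first.
  rewrite (_ : [set y | _] = set0) ?cards0 //.
  by apply/setP => p; rewrite !inE (negbTE nlx).
have low b : #|nbr r b x| <= D by case/andP: lx; case: b.
apply: leq_trans (leq_mul (low (~~ b1)) (low b2)); rewrite -cardsX subset_leq_card //.
by apply/subsetP => p; rewrite !inE /= => /and4P[_ _ _ /and3P[_ _]]; rewrite /fit dirN.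
Qed.

Lemma many_serving b1 b2 U vi : #|U| <= u ->
  k * (h * h) <= #|[set t in candidates b1 b2 U | serves b1 b2 t.1 t.2 vi]|.
Proof.
case: vi => v i Uu.
have degU b : 2 * k <= #|nbr r0 b v :\: U|.
  have := cardsID U (nbr r0 b v); have := subset_leq_card (subsetIr (nbr r0 b v) U).
  have := Hdeg b v; lia.
have [A [B [sA sB cA cB dAB]]] := two_disjoint_subsets (degU (~~ b1)) (degU b2).
have AP y : y \in A -> y \notin U /\ dir r0 b1 y v.
  by move=> /(subsetP sA); rewrite !inE dirN => /andP[].
have BP y : y \in B -> y \notin U /\ dir r0 b2 v y.
  by move=> /(subsetP sB); rewrite !inE => /andP[].
pose T := S i :\: (U :|: A :|: B).
have cT : 4 * k <= #|T|.
  have := cardsID (U :|: A :|: B) (S i).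
  have := subset_leq_card (subsetIr (S i) (U :|: A :|: B)).
  by rewrite !cardsU; have := HS i; rewrite /T; lia.
have dA : [disjoint A & T].
  by rewrite -setI_eq0; apply/eqP/setP=> z; rewrite !inE; case: (z \in A); rewrite ?orbT.
have dB : [disjoint B & T].
  by rewrite -setI_eq0; apply/eqP/setP=> z; rewrite !inE; case: (z \in B); rewrite ?orbT.
have pA := few_poor b1 k0 Hdense cA dA.
have pB := few_poor (~~ b2) k0 Hdense cB dB.
have pH := few_high_degree HM HMD.
pose nA x := [set a in A | dir r b1 a x].
pose nB x := [set a in B | dir r b2 x a].
pose W := [set x in T | [&& low_degree r D x, h <= #|nA x| & h <= #|nB x|]].
have cW : k <= #|W|.
  have : T \subset W :|: ([set x | ~~ low_degree r D x] :|:
      ([set x in T | #|nA x| < h] :|: [set x in T | #|nB x| < h])).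
    apply/subsetP => x xT; rewrite 3!in_setU [x \in W]in_set.
    rewrite [x \in [set _ in T | _ < _]]in_set [x \in [set _ in T | _ < _]]in_set in_set xT /= !ltnNge.
    by case: low_degree; case: (h <= _); case: (h <= _).
  have -> : [set x in T | #|nB x| < h] =
      [set x in T | #|[set a in B | dir r (~~ b2) a x]| < h].
    apply/setP => x; rewrite !inE; congr (_ && (_ < _)); apply: eq_card => a.
    by rewrite !inE dirN.
  move/subset_leq_card; rewrite !cardsU; have {}pA : #|[set x in T | #|nA x| < h]| < k := pA; lia.
rewrite card_prod_sum.
apply: leq_trans (leq_mul cW (leqnn (h * h))) _.
rewrite -sum_nat_const big_mkcond leq_sum // => x _; case: ifP => // xW.
move: (xW); rewrite inE => /andP[xT /and3P[lx hA hB]].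
apply: leq_trans (leq_mul hA hB) _; rewrite -cardsX subset_leq_card //.
move: xT; rewrite !inE !negb_or -!andbA => /and4P[xU xA xB xS].
apply/subsetP => -[y z]; rewrite !inE /= => /andP[/andP[yA yx] /andP[zB zx]].
have [[yU yv] [zU zv]] := (AP _ yA, BP _ zB).
rewrite lx xU yU zU /serves /fit /= yx zx yv zv xS !inE !andbT negb_or.
rewrite -andbA; apply/and3P; split.
- by apply: contraNneq xA => <-.
- by apply: contraTneq yA => ->; rewrite (disjointFl dAB zB).
- by apply: contraNneq xB => ->.
Qed.

Lemma gadget_step b1 b2 U (f : V * I -> nat) : 0 < #|V| -> 0 < #|I| -> #|U| <= u ->
  exists y x z, [/\ {in [:: y; x; z], forall t, t \notin U}, uniq [:: y; x; z],
    fit r b1 b2 (y, z) x &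
    \sum_vi f vi <= K0 * \sum_(vi | serves b1 b2 x (y, z) vi) f vi].
Proof.
move=> /card_gt0P[v _] /card_gt0P[i _] Uu.
pose T := candidates b1 b2 U; set F := \sum_vi f vi.
pose good (t : V * (V * V)) := F <= K0 * \sum_(vi | serves b1 b2 t.1 t.2 vi) f vi.
case: (pickP (fun t => (t \in T) && good t)) => [[x [y z]] /andP[]|nog].
  rewrite inE /= => /and4P[_ xU yU /and3P[zU un fi]] gt.
  exists y, x, z; split=> // t; rewrite !inE.
  by case/or3P=> /eqP->.
exfalso.
have T0 : 0 < #|T|.
  have := many_serving b1 b2 (v, i) Uu.
  have : 0 < k * (h * h) by rewrite !muln_gt0 k0 h0.
  have : #|[set t in T | serves b1 b2 t.1 t.2 (v, i)]| <= #|T|.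
    by rewrite subset_leq_card //; apply/subsetP => t; rewrite inE => /andP[].
  rewrite -/T; lia.
have up : \sum_(t in T) (K0 * \sum_(vi | serves b1 b2 t.1 t.2 vi) f vi) < #|T| * F.
  apply: leq_trans (_ : \sum_(t in T) (K0 * \sum_(vi | serves b1 b2 t.1 t.2 vi) f vi) + #|T| <= _).
    by lia.
  rewrite -sum_nat_const -sum1_card -big_split /=; apply: leq_sum => t tT.
  by have := nog t; rewrite tT /good /=; lia.
have lo : K0 * (k * (h * h)) * F <= \sum_(t in T) (K0 * \sum_(vi | serves b1 b2 t.1 t.2 vi) f vi).
  rewrite -big_distrr /= -mulnA leq_mul2l; apply/orP; right.
  rewrite (exchange_big_dep xpredT) //= mulnC /F big_distrl /=; apply: leq_sum => vi _.
  rewrite mulnC sum_nat_cond_const mulnC [X in _ <= X]mulnC leq_mul2l; apply/orP; right.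
  by rewrite (leq_trans (many_serving b1 b2 vi Uu)) // eq_leq //.
have := leq_trans (leq_mul (card_candidates b1 b2 U) (leqnn F)) (leq_mul HK0 (leqnn F)).
rewrite -/T; lia.
Qed.

(* With [f = 1], the potential grows by a factor at most [2 - 1/K0] per gadget,
   while a pair [vi] served by few gadgets contributes nearly [2 ^ m] to it. *)
Lemma gadgets x0 : 0 < #|V| -> 0 < #|I| ->
  forall m (w1 w2 : nat -> bool) U (f : V * I -> nat), #|U| + 3 * m <= u ->
  exists ps xs, [/\ size ps = m, size xs = m, uniq (flat ps ++ xs),
    {in flat ps ++ xs, forall x, x \notin U} &
    (forall j, j < m -> fit r (w1 j) (w2 j) (nth (x0, x0) ps j) (nth x0 xs j)) /\
    K0 ^ m * \sum_vi f vi * 2 ^ (m - \sum_(j < m)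
      serves (w1 j) (w2 j) (nth x0 xs j) (nth (x0, x0) ps j) vi) <=
    (2 * K0 - 1) ^ m * \sum_vi f vi].
Proof.
move=> V0 I0; elim=> [|m IH] w1 w2 U f Um.
  exists [::], [::]; split=> //; split=> //.
  by rewrite !expn0 !mul1n eq_leq //; apply: eq_bigr => vi _; rewrite expn0 muln1.
have Uu : #|U| <= u by lia.
have [y [x [z [nU un fi st]]]] := gadget_step (w1 0) (w2 0) f V0 I0 Uu.
pose g vi := if serves (w1 0) (w2 0) x (y, z) vi then f vi else 2 * f vi.
have [yU xU zU] : [/\ y \notin U, x \notin U & z \notin U].
  by split; apply: nU; rewrite !inE eqxx ?orbT.
move: (un); rewrite /= !inE negb_or !andbT => /andP[/andP[yx yz] xz].
have cU : #|y |: (x |: (z |: U))| <= #|U| + 3.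
  by rewrite !cardsU1; move: (y \notin _) (x \notin _) (z \notin _) #|U| => [] [] [] c; lia.
have [|ps [xs [sp sx up dp [hp hk]]]] := IH (fun j => w1 j.+1) (fun j => w2 j.+1)
  (y |: (x |: (z |: U))) g; first lia.
have nin t : t \in [:: y; x; z] -> (t \notin flat ps) && (t \notin xs).
  by move=> ht; rewrite -negb_or -mem_cat; apply/negP => /dp; move: ht;
    rewrite !inE => /or3P[]->; rewrite ?orbT.
have /andP[y1 y2] := nin y (mem_head _ _).
have /andP[x1 x2] : (x \notin flat ps) && (x \notin xs) by apply: nin; rewrite !inE eqxx orbT.
have /andP[z1 z2] : (z \notin flat ps) && (z \notin xs) by apply: nin; rewrite !inE eqxx !orbT.
exists ((y, z) :: ps), (x :: xs); split.
- by rewrite /= sp.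
- by rewrite /= sx.
- have pe : perm_eq (flat ((y, z) :: ps) ++ (x :: xs)) ([:: y; x; z] ++ flat ps ++ xs).
    by rewrite /flat /= -/(flat ps) perm_cons;
      exact: (permEl (perm_catCA (z :: flat ps) [:: x] xs)).
  rewrite (perm_uniq pe) cat_uniq up un andbT /=; apply/hasPn => t ht.
  by apply/negP => /nin; rewrite -negb_or -mem_cat ht.
- move=> t; rewrite mem_cat /flat /= -/(flat ps) !inE.
  case/orP=> [/or3P[/eqP->|/eqP->|tp]|/orP[/eqP->|tp]] //.
    by have := dp t; rewrite mem_cat tp => /(_ isT); rewrite !inE !negb_or => /and4P[].
  by have := dp t; rewrite mem_cat tp orbT => /(_ isT); rewrite !inE !negb_or => /and4P[].
split; first by case=> [|j] //= /hp.
set c := fun vi => \sum_(j < m) serves (w1 j.+1) (w2 j.+1) (nth x0 xs j) (nth (x0, x0) ps j) vi.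
have cm vi : c vi <= m.
  rewrite -[X in _ <= X]card_ord -sum1_card; apply: leq_sum => j _; exact: leq_b1.
have -> : \sum_vi f vi * 2 ^ (m.+1 - \sum_(j < m.+1) serves (w1 j) (w2 j)
    (nth x0 (x :: xs) j) (nth (x0, x0) ((y, z) :: ps) j) vi) =
    \sum_vi g vi * 2 ^ (m - c vi).
  apply: eq_bigr => vi _; rewrite big_ord_recl /= -/(c vi) /g.
  case: (serves _ _ _ _ _) => /=; first by rewrite subSS.
  by rewrite add0n subSn ?cm // expnS mulnCA mulnA.
rewrite !expnS -mulnA.
apply: leq_trans (leq_mul (leqnn K0) hk) _.
have gF : \sum_vi g vi + \sum_(vi | serves (w1 0) (w2 0) x (y, z) vi) f vi =
    2 * \sum_vi f vi.
  rewrite [X in _ + X]big_mkcond -big_split /= big_distrr /=; apply: eq_bigr => vi _.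
  by rewrite /g; case: ifP => _; rewrite ?addn0 ?mul2n ?addnn.
rewrite mulnCA -mulnA [X in _ <= X]mulnCA leq_mul2l.
by apply/orP; right; apply: potential_drop st gF.
Qed.
End GadgetSelection.

End Gadgets.

(** * Assembling long cycles *)

Lemma uniq_catI (T : eqType) (s1 s2 : seq T) :
  uniq s1 -> uniq s2 -> {in s2, forall x, x \notin s1} -> uniq (s1 ++ s2).
Proof. by move=> u1 u2 h; rewrite cat_uniq u1 u2 andbT; apply/hasPn. Qed.

Section Assembly.
Variable V : finType.
Implicit Types (r : rel V) (b : bool) (U A B S : {set V}) (p : V * V).

Fixpoint fill (ps cc : seq (V * V)) (us : seq V) : seq V :=
  match ps, cc, us with
  | p :: ps', c :: cc', v :: us' =>
      [:: c.1, c.2, p.1, v, p.2 & fill ps' cc' us']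
  | _, _, _ => [::]
  end.

Lemma size_fill ps cc us : size cc = size ps -> size us = size ps ->
  size (fill ps cc us) = 5 * size ps.
Proof.
elim: ps cc us => [|p ps IH] [|c cc] [|v us] //= [sc] [su].
by rewrite IH // [RHS]mulnS.
Qed.

Lemma last_fill x ps cc us : size cc = size ps -> size us = size ps ->
  last x (fill ps cc us) = last x [seq p.2 | p <- ps].
Proof.
by elim: ps cc us x => [|p ps IH] [|c cc] [|v us] x //= [sc] [su]; rewrite IH.
Qed.

Lemma count_fill a ps cc us : size cc = size ps -> size us = size ps ->
  count a (fill ps cc us) = count a (flat ps) + count a (flat cc) + count a us.
Proof.
elim: ps cc us => [|p ps IH] [|c cc] [|v us] //= [sc] [su].
rewrite IH // /flat /= -/(flat ps) -/(flat cc).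
by move: (a c.1 : nat) (a c.2 : nat) (a v : nat) (a p.1 : nat) (a p.2 : nat) => *; lia.
Qed.

Lemma flat_cat (ps qs : seq (V * V)) : flat (ps ++ qs) = flat ps ++ flat qs.
Proof. by rewrite /flat map_cat flatten_cat. Qed.

Lemma size_flat (ps : seq (V * V)) : size (flat ps) = 2 * size ps.
Proof. by elim: ps => //= p ps IH; rewrite /flat /= -/(flat ps) IH mulnS. Qed.

Lemma connectors r k u x0 : joined r k -> (forall b x, u + 2 * k <= #|nbr r b x|) ->
  forall ps x w j U, #|U| + 2 * size ps <= u ->
  exists cc, [/\ size cc = size ps, uniq (flat cc), {in flat cc, forall c, c \notin U} &
    forall us, size us = size ps ->
      (forall i, i < size ps -> fit r (w (j + 5 * i + 3)) (w (j + 5 * i + 4))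
         (nth (x0, x0) ps i) (nth x0 us i)) ->
      wpath r w j x (fill ps cc us)].
Proof.
move=> J deg; elim=> [|[y z] ps IH] x w j U Uu; first by exists [::].
rewrite /= in Uu.
have degU b v : 2 * k <= #|nbr r b v :\: U|.
  have := cardsID U (nbr r b v); have := subset_leq_card (subsetIr (nbr r b v) U).
  have := deg b v; lia.
have [A [B [sA sB cA cB dAB]]] :=
  two_disjoint_subsets (degU (w j) x) (degU (~~ w j.+2) y).
have [||c [c' [cA' cB' cc']]] := joined_dir J (w j.+1) dAB; rewrite ?cA ?cB //.
have := subsetP sA _ cA'; have := subsetP sB _ cB'; rewrite !inE dirN.
move=> /andP[cU' cy] /andP[cU xc].
have ncc : c != c' by apply: contraTneq cA' => ->; rewrite (disjointFl dAB cB').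
have cU2 : #|c |: (c' |: U)| = #|U| + 2.
  by rewrite !cardsU1 !inE (negbTE ncc) (negbTE cU) cU'; lia.
have [|cc [sc uc dc hc]] := IH z w (j + 5) (c |: (c' |: U)); first by rewrite cU2; lia.
exists ((c, c') :: cc); split.
- by rewrite /= sc.
- rewrite /flat /= -/(flat cc) uc inE negb_or ncc !andbT /=.
  by apply/andP; split; apply/negP => /dc; rewrite !inE eqxx ?orbT.
- move=> t; rewrite /flat /= -/(flat cc) !inE => /or3P[/eqP->|/eqP->|/dc] //.
  by rewrite !inE !negb_or => /and3P[].
case=> [//|v us] [su] fi /=.
have := fi 0 isT; rewrite muln0 addn0 addn3 addn4 /fit /= => /andP[-> ->].
rewrite xc cc' cy /= (_ : j.+4.+1 = j + 5); last by rewrite addnC.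
apply: hc => // i ips.
by have := fi i.+1 ips; rewrite /= mulnS addnA.
Qed.

Lemma swap_leftover m xs (okC okG : nat -> V -> bool) x0 t : size xs = m ->
    (forall j, j < m -> okG j (nth x0 xs j)) ->
  forall ls, size ls <= t ->
    (forall i v, i < size ls -> v \in ls ->
       t <= \sum_(j < m) (okC i (nth x0 xs j) && okG j v)) ->
  exists oc og, [/\ size oc = size ls, size og = m,
    (forall i, i < size ls -> okC i (nth x0 oc i)),
    (forall j, j < m -> okG j (nth x0 og j)) & perm_eq (oc ++ og) (ls ++ xs)].
Proof.
move=> sx hx ls lt hl.
suff [oc [og [? ? ? ? [? ?]]]] : exists oc og, [/\ size oc = size ls, size og = m,
    (forall i, i < size ls -> okC i (nth x0 oc i)),
    (forall j, j < m -> okG j (nth x0 og j)) & perm_eq (oc ++ og) (ls ++ xs) /\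
    \sum_(j < m) (nth x0 og j != nth x0 xs j) <= size ls] by exists oc, og.
elim/last_ind: ls lt hl => [|ls v IH] lt hl.
  exists [::], xs; split=> //; split=> //.
  by rewrite big1 // => j _; rewrite eqxx.
rewrite size_rcons in lt hl.
have [||oc [og [so sg hoc hog [pe df]]]] := IH; first by lia.
  move=> i v' il vl; apply: hl; first by lia.
  by rewrite mem_rcons inE vl orbT.
have [j /and3P[jC jG /eqP jx]] : exists j : 'I_m, [&& okC (size ls) (nth x0 xs j),
    okG j v & nth x0 og j == nth x0 xs j].
  apply/existsP; apply: contraLR lt => /existsPn nj; rewrite -leqNgt.
  apply: leq_trans (hl (size ls) v _ _) _ => //; first by rewrite mem_rcons mem_head.
  apply: leq_trans df; apply: leq_sum => j _.
  by have := nj j; case: (okC _ _); case: (okG _ _); case: eqP.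
exists (rcons oc (nth x0 xs j)), (set_nth x0 og j v); split.
- by rewrite !size_rcons so.
- by rewrite size_set_nth sg; apply/maxn_idPr.
- move=> i; rewrite size_rcons ltnS nth_rcons so; case: ltngtP => // [il _|-> _] //.
  exact: hoc.
- by move=> i im; rewrite nth_set_nth /=; case: eqP => [->|_] //; apply: hog.
split.
  have jg : j < size og by rewrite sg.
  apply/permP => a; have /permP/(_ a) := pe.
  rewrite set_nthE jg -!cats1 -{1}(cat_take_drop j og) (drop_nth x0 jg) jx.
  rewrite !count_cat /=; move: (a v : nat) (a (nth x0 xs j) : nat) => *; lia.
rewrite size_rcons (bigD1 j) //=; apply: (leq_trans (leq_add (leq_b1 _) (leqnn _))).
rewrite add1n ltnS (leq_trans _ df) // [X in _ <= X](bigD1 j) //=.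
apply: leq_trans (leq_addl _ _); rewrite leq_sum // => i ij.
by rewrite nth_set_nth /= (negbTE (_ : (i : nat) != j)) //.
Qed.

End Assembly.

Section LongCycles.
Variable V : finType.

Lemma dir_sub (r r' : rel V) : subrel r r' -> forall b, subrel (dir r b) (dir r' b).
Proof. by move=> h [] x y; apply: h. Qed.

Lemma fit_sub (r r' : rel V) : subrel r r' ->
  forall b1 b2 p x, fit r b1 b2 p x -> fit r' b1 b2 p x.
Proof. by move=> h b1 b2 p x /andP[/(dir_sub h) ? /(dir_sub h) ?]; apply/andP. Qed.

Lemma card_seq_le (T : finType) (s : seq T) : #|[set x in s]| <= size s.
Proof. by rewrite cardsE card_size. Qed.

Lemma long_cycle (r0 g r : rel V) (k h D M K0 m c q s u d l : nat) w :
    subrel r0 r -> subrel g r ->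
    0 < k -> 0 < h -> 0 < K0 -> 0 < c ->
    dense g k h -> joined r q ->
    \sum_x #|nbr g true x| <= M -> 2 * M < k * D.+1 ->
    #|V| * (D * D) <= K0 * (k * (h * h)) ->
    (forall b x, d <= #|nbr r0 b x|) ->
    u = 5 * (m + c) + 1 -> 2 * (u + 1) <= d -> u + 2 * k <= d -> u + 2 * q <= d ->
    2 * (#|V| * s) <= d * d -> u + 6 * k <= s -> 8 * q <= c ->
    (2 * K0 - 1) ^ m * (#|V| * c) * 2 ^ c <= (2 * K0) ^ m ->
    u + 2 <= l <= #|V| ->
  exists x t, [/\ size t = l.-1, uniq (x :: t) & wpath r w 0 x (rcons t x)].
Proof.
move=> r0r gr k0 h0 K00 c0 Hd J HM HMD HK deg ue ud ukd uqd sd us qc Hm /andP[ul lV].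
have V0 : 0 < #|V| by lia.
have /card_gt0P[x _] := V0.
have degr b y : d <= #|nbr r b y|.
  rewrite (leq_trans (deg b y)) // subset_leq_card //; apply/subsetP => z.
  by rewrite !inE; apply: dir_sub.
pose w1 j := w (5 * j + 3); pose w2 j := w (5 * j + 4).
have [|pc [sc uc dc hc]] := @centers V r0 d s u V0 deg ud sd c w1 w2 [set x] x.
  by rewrite cards1; lia.
pose S (i : 'I_c) := [set y | fit r0 (w1 i) (w2 i) (nth (x, x) pc i) y].
have HS i : u + 6 * k <= #|S i| by apply: leq_trans us _; apply: hc.
pose Q1 := x :: flat pc.
have U1 : #|[set y in Q1]| + 3 * m <= u.
  by have := card_seq_le Q1; rewrite /= size_flat sc; lia.
have uQ1 : uniq Q1 by rewrite /= uc andbT; apply/negP => /dc; rewrite inE eqxx.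
have Hdegk b y : u + 2 * k <= #|nbr r0 b y| by apply: leq_trans ukd _.
have I0 : 0 < #|'I_c| by rewrite card_ord.
have [pg [xs [sg sx ug dg [hg hk]]]] := gadgets k0 h0 Hd HM HMD Hdegk HS HK x V0 I0
  (fun j => w1 (c + j)) (fun j => w2 (c + j)) (fun=> 1) U1.
pose Q2 := Q1 ++ (flat pg ++ xs).
have uQ2 : uniq Q2 by apply: uniq_catI => // y /dg; rewrite !inE.
have sQ2 : size Q2 = 1 + 2 * c + 3 * m.
  by rewrite size_cat /= size_cat !size_flat sc sg sx; lia.
have sp : size (pc ++ pg) = c + m by rewrite size_cat sc sg.
have U2 : #|[set y in Q2]| + 2 * size (pc ++ pg) <= u.
  by have := card_seq_le Q2; rewrite sQ2 sp; lia.
have Hdegq b y : u + 2 * q <= #|nbr r b y| by apply: leq_trans uqd _.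
have [cc [scc ucc dcc hcc]] := connectors x J Hdegq x w 0 U2.
pose Q3 := Q2 ++ flat cc.
have uQ3 : uniq Q3 by apply: uniq_catI => // y /dcc; rewrite !inE.
have sQ3 : size Q3 = u - c by rewrite size_cat sQ2 size_flat scc sp; lia.
pose W := ~: [set y in Q3].
have cW : #|W| = #|V| - (u - c).
  have := cardsC [set y in Q3]; rewrite {1}cardsE (card_uniqP uQ3) sQ3 -/W; lia.
pose z := last x [seq p.2 | p <- pc ++ pg].
pose kk := 5 * (c + m); pose len := l - (u + 2).
have degW b y : 2 * q <= #|[set a in W | dir r b y a]|.
  have := cardsID [set y in Q3] (nbr r b y); have := card_seq_le Q3.
  have := subset_leq_card (subsetIr (nbr r b y) [set y in Q3]).
  rewrite sQ3; have := Hdegq b y.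
  have -> : nbr r b y :\: [set y in Q3] = [set a in W | dir r b y a].
    by apply/setP => a; rewrite !inE.
  lia.
have [||t [st ut tW pt]] := @connecting_path V r q (fun i => w (kk + i)) z x W len J (degW _ _).
- rewrite (leq_trans (degW (~~ w (kk + len.+2)) x)) // subset_leq_card //.
  by apply/subsetP => y; rewrite !inE dirN.
- by rewrite cW /len; lia.
have tQ3 y : y \in t -> y \notin Q3 by move=> /tW; rewrite !inE.
have [L sL cL] : exists2 L : {set V}, L \subset W :\: [set y in t] & #|L| = c.
  apply: subset_of_card.
  have := cardsID [set y in t] W; have := card_seq_le t.
  have := subset_leq_card (subsetIr W [set y in t]); rewrite st /len cW; lia.
pose ls := enum L.
have LP y : y \in ls -> y \notin Q3 /\ y \notin t.
  by rewrite mem_enum => /(subsetP sL); rewrite !inE => /andP[].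
have sls : size ls = c by rewrite -cardE.
have count v i : i < c -> c <= \sum_(j < m) (fit r (w1 i) (w2 i) (nth (x, x) pc i) (nth x xs j)
    && fit r (w1 (c + j)) (w2 (c + j)) (nth (x, x) pg j) v).
  move=> ic; pose vi := (v, Ordinal ic).
  apply: leq_trans (_ : \sum_(j < m) serves r0 S (w1 (c + j)) (w2 (c + j)) (nth x xs j)
    (nth (x, x) pg j) vi <= _); last first.
    apply: leq_sum => j _; case E: (serves _ _ _ _ _ _ _) => //.
    move: E; rewrite /serves inE /= => /andP[/(fit_sub r0r)-> /(fit_sub r0r)->] //.
  rewrite leqNgt; apply/negP => lt.
  move: hk; rewrite (bigD1 vi) //= mul1n mulnDr => /(leq_trans (leq_addr _ _)).
  rewrite sum_nat_const card_prod card_ord muln1 => hk.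
  move: hk lt; set e := (\sum_(j < m) _) => hk lt.
  have := leq_trans (leq_mul hk (leqnn (2 ^ c))) Hm.
  rewrite -mulnA -expnD expnMn mulnC leq_pmul2r ?expn_gt0 ?K00 //.
  by rewrite leq_exp2l //; lia.
have hxs j : j < m -> fit r (w1 (c + j)) (w2 (c + j)) (nth (x, x) pg j) (nth x xs j).
  by move=> jm; apply: fit_sub gr _ _ _ _ (hg j jm).
have [|oc [og [soc sog hoc hog pe]]] := @swap_leftover V m xs
  (fun i => fit r (w1 i) (w2 i) (nth (x, x) pc i))
  (fun j => fit r (w1 (c + j)) (w2 (c + j)) (nth (x, x) pg j)) x c sx hxs ls (eq_leq sls).
- by move=> i v; rewrite sls => ic _; apply: count.
have sus : size (oc ++ og) = size (pc ++ pg) by rewrite size_cat soc sls sog sp.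
exists x, (fill (pc ++ pg) cc (oc ++ og) ++ t); split.
- by rewrite size_cat size_fill // sp st /len; lia.
- have pp : perm_eq (x :: fill (pc ++ pg) cc (oc ++ og) ++ t) (Q3 ++ (ls ++ t)).
    apply/permP => a; have /permP/(_ a) := pe.
    rewrite /Q3 /Q2 /= !count_cat count_fill // flat_cat !count_cat /=.
    by move: (a x : nat) => *; lia.
  rewrite (perm_uniq pp); apply: uniq_catI => //.
    apply: uniq_catI; rewrite ?enum_uniq // => y yt.
    by apply/negP => /LP[_]; rewrite yt.
  by move=> y; rewrite mem_cat => /orP[/LP[]|/tQ3].
rewrite rcons_cat wpath_cat size_fill // last_fill // sp -/z add0n.
apply/andP; split; last by move: pt; rewrite wpath_shift addn0.
apply: hcc => // i; rewrite sp !add0n => ip.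
rewrite !nth_cat sc soc sls; case: ltnP => ic; first by apply: hoc; rewrite sls.
have := hog (i - c); rewrite subnKC //; apply; lia.
Qed.

End LongCycles.

(** * Cycles in pseudorandom perturbations *)

Section PseudorandomEvent.
Variable n : nat.
Implicit Type D : digraph 'I_n.

Definition kpair k (AB : {set 'I_n} * {set 'I_n}) : bool :=
  [&& [disjoint AB.1 & AB.2], #|AB.1| == k & #|AB.2| == k].

Definition spread k t D : bool :=
  [forall AB : {set 'I_n} * {set 'I_n},
     kpair k AB ==> (t <= #|edges D :&: setX AB.1 AB.2|)].

Definition reverse D : {set 'I_n * 'I_n} := [set e | edge D e.2 e.1].

Definition pseudorandom k t q M D0 D : bool :=
  [&& spread k t D, spread q 1 D, #|edges D| <= M & edges D :&: reverse D0 != set0].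

End PseudorandomEvent.

Lemma min_semidegree_le (V : finType) (D : digraph V) v :
  min_semidegree D <= minn (outdeg D v) (indeg D v).
Proof.
rewrite /min_semidegree; have := mem_index_enum v.
elim: (index_enum V) => // x s IH; rewrite big_cons inE => /orP[/eqP->|/IH vs].
  exact: geq_minl.
by rewrite (leq_trans _ vs) // geq_minr.
Qed.

Lemma min_semidegree_nbr (V : finType) (D : digraph V) b v :
  min_semidegree D <= #|nbr (edge D) b v|.
Proof.
apply: leq_trans (min_semidegree_le D v) _.
by case: b; [apply: geq_minl | apply: geq_minr].
Qed.

Lemma sum_outdeg (V : finType) (D : digraph V) :
  \sum_v #|nbr (edge D) true v| = #|edges D|.
Proof.
by rewrite card_prod_sum; apply: eq_bigr => x _; apply: eq_card => y; rewrite !inE.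
Qed.

Lemma edges_ge (V : finType) (D : digraph V) :
  #|V| * min_semidegree D <= #|edges D|.
Proof.
by rewrite -sum_outdeg -sum_nat_const leq_sum // => v _; apply: min_semidegree_nbr.
Qed.

Lemma spread_edges n (D : digraph 'I_n) k t (A B : {set 'I_n}) : spread k t D ->
  [disjoint A & B] -> #|A| = k -> #|B| = k ->
  t <= \sum_(a in A) #|[set b in B | edge D a b]|.
Proof.
move=> /forallP/(_ (A, B))/implyP h dAB cA cB.
apply: leq_trans (h _) _; first by rewrite /kpair /= dAB cA cB !eqxx.
rewrite card_prod_sum [X in _ <= X]big_mkcond leq_sum //= => a _.
case: ifP => aA; last first.
  rewrite leqn0 cards_eq0; apply/eqP/setP => b; rewrite !inE /=.
  by rewrite aA andbF.
rewrite subset_leq_card //; apply/subsetP => b.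
by rewrite !inE /= => /and3P[? _ ->].
Qed.

Lemma spread_joined n (D : digraph 'I_n) q : spread q 1 D -> joined (edge D) q.
Proof.
move=> sp A B dAB /subset_of_card[A' sA cA] /subset_of_card[B' sB cB].
have dAB' := disjointW sA sB dAB.
have := spread_edges sp dAB' cA cB; rewrite lt0n sum_nat_eq0 negb_forall.
case/existsP=> a; rewrite negb_imply -lt0n => /andP[aA /card_gt0P[b]].
rewrite inE => /andP[bB ab].
by exists a, b; rewrite (subsetP sA) ?(subsetP sB).
Qed.

Lemma pseudorandom_cycles n (D0 G : digraph 'I_n) (d k h D M K0 m c q s u : nat) :
    0 < k -> 0 < h -> 0 < K0 -> 0 < c -> 2 * M < k * D.+1 ->
    n * (D * D) <= K0 * (k * (h * h)) -> d <= min_semidegree D0 ->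
    u = 5 * (m + c) + 1 -> 2 * (u + 1) <= d -> u + 2 * k <= d -> u + 2 * q <= d ->
    2 * (n * s) <= d * d -> u + 6 * k <= s -> 8 * q <= c ->
    (2 * K0 - 1) ^ m * (n * c) * 2 ^ c <= (2 * K0) ^ m ->
    u + 2 + 8 * q <= n ->
    pseudorandom k (k * h) q M D0 G ->
  contains_all_cycle_orientations (dunion D0 G).
Proof.
move=> k0 h0 K00 c0 HMD HK dD ue ud ukd uqd sd us qc Hm un /and4P[spk spq eM].
case/set0Pn=> -[a b]; rewrite !inE /= => /andP[abG baD0].
set E := dunion D0 G.
have sub0 : subrel (edge D0) (edge E) by move=> x y xy; rewrite /edge inE [_ \in _]xy.
have subG : subrel (edge G) (edge E) by move=> x y xy; rewrite /edge inE [_ \in edges G]xy orbT.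
have deg bb x : d <= #|nbr (edge D0) bb x| by apply: leq_trans dD (min_semidegree_nbr _ _ _).
have JG := spread_joined spq.
have J : joined (edge E) q.
  move=> A B dAB qA qB; have [x [y [xA yB xy]]] := JG A B dAB qA qB.
  by exists x, y; split=> //; apply: subG.
have dG : dense (edge G) k h by move=> A B; apply: spread_edges.
have irr : irreflexive (edge E).
  by move=> x; apply: negbTE; apply: (forallP (edges_loopless E)).
have HM : \sum_x #|nbr (edge G) true x| <= M by rewrite sum_outdeg.
apply/forallP => l; apply/implyP => l2; apply/forallP => H; apply/implyP => oH.
have ln : l <= n by rewrite -ltnS.
have [le2|l3] : l = 2 :> nat \/ 3 <= l by lia.
  move: (nat_of_ord l) le2 H {oH} => l' -> H.
  by apply: (@contains_2cycle _ _ _ a b); [apply: subG | apply: sub0].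
have [llong|lshort] := leqP (u + 2) l.
  have [x [t [st ut pt]]] : exists x t, [/\ size t = l.-1, uniq (x :: t)
      & wpath (edge E) (cword H) 0 x (rcons t x)].
    by apply: (@long_cycle _ (edge D0) (edge G) (edge E) k h D M K0 m c q s u d l);
      rewrite ?card_ord ?llong.
  exact: contains_closed_walk st ut pt.
have [||t [st ut pt]] := @short_cycle _ (edge E) q (cword H) l a J irr _ l3.
- move=> bb; apply: leq_trans (_ : d <= _); first by lia.
  rewrite (leq_trans (deg bb a)) // subset_leq_card //; apply/subsetP => y.
  by rewrite !inE; apply: dir_sub.
- by rewrite card_ord; lia.
exact: contains_closed_walk st ut pt.
Qed.

Lemma bernoulli_nat b N : (b + N) * b ^ N <= b * b.+1 ^ N.
Proof.
elim: N => [|N IH]; first by rewrite !expn0 addn0.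
rewrite [b.+1 ^ _]expnS mulnCA; apply: leq_trans (leq_mul (leqnn b.+1) IH).
by rewrite expnS; nia.
Qed.

Lemma pow_gap b : 0 < b -> 4 * b ^ (3 * b) <= b.+1 ^ (3 * b).
Proof.
move=> b0; have := bernoulli_nat b (3 * b).
by rewrite -mulSn -mulnA mulnCA leq_pmul2l.
Qed.

Lemma potential_bound K0 c n : 0 < K0 -> n * c <= 2 ^ c ->
  (2 * K0 - 1) ^ (3 * (2 * K0 - 1) * c) * (n * c) * 2 ^ c <=
  (2 * K0) ^ (3 * (2 * K0 - 1) * c).
Proof.
move=> K00 nc; have [b b0 ->] : exists2 b, 0 < b & 2 * K0 = b.+1.
  by exists (2 * K0).-1; lia.
rewrite subn1 !(expnM _ (3 * b) c); have := pow_gap b0.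
move: (b ^ (3 * b)) (b.+1 ^ (3 * b)) => x y xy; rewrite -mulnA.
apply: leq_trans (leq_mul (leqnn _) (leq_mul nc (leqnn _))) _.
case: c {nc} => [|c]; first by rewrite !expn0.
by rewrite -!expnMn leq_exp2r // mulnC.
Qed.

Lemma cube_le_pow q : 10 * (q * q * q) <= 2 ^ (10 * q).
Proof.
have [->|q0] := posnP q; first by rewrite !muln0.
have qx : q <= 2 ^ q by apply: ltnW; apply: ltn_expl.
have x2 : 2 <= 2 ^ q by rewrite -{1}[2]expn1 leq_exp2l.
have h7 : 10 <= (2 ^ q) ^ 7.
  by apply: (@leq_trans (2 ^ 7)); [|rewrite leq_exp2r].
rewrite [10 * q]mulnC expnM (expnD _ 7 3); move: (2 ^ q) qx h7 {x2} => x qx h7.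
apply: leq_mul => //; rewrite 2!expnS expn1 mulnA.
by apply: leq_mul => //; apply: leq_mul.
Qed.

Lemma perturbed_cycles a : 0 < a -> exists K1 kap h, [/\ a <= K1, 0 < kap,
  5 * K1 * (kap * kap) <= h &
  forall q n, 2 * (K1 * kap) <= q -> K1 * kap * q <= n -> n <= 2 * (K1 * kap * q) ->
  forall D0 G : digraph 'I_n, n <= a * min_semidegree D0 ->
    pseudorandom (kap * q) (kap * q * h) q (32 * K1 * h * n) D0 G ->
  contains_all_cycle_orientations (dunion D0 G)].
Proof.
move=> a0; have [K1 K1E] : exists K1, K1 = 14 * (a * a) by eexists.
have [K0 K0E] : exists K0, K0 = 2 * K1 * ((128 * K1 * K1) * (128 * K1 * K1)) by eexists.
have [kap kapE] : exists kap, kap = 50 * (3 * (2 * K0 - 1) + 1) + 1 by eexists.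
have [h hE] : exists h, h = 5 * K1 * (kap * kap) by eexists.
have aK : a <= K1 by rewrite K1E mulnA leq_pmull // muln_gt0.
have K10 : 0 < K1 by apply: leq_trans aK.
have K00 : 0 < K0 by rewrite K0E !muln_gt0 K10.
have kap0 : 0 < kap by rewrite kapE addn1.
have h0 : 0 < h by rewrite hE !muln_gt0 K10 kap0.
exists K1, kap, h; split; rewrite ?hE // -hE => q n Kq nlo nhi D0 G deg.
have q0 : 0 < q by apply: leq_trans Kq; rewrite !muln_gt0 K10 kap0.
have [k kE] : exists k, k = kap * q by eexists.
have [d dE] : exists d, d = min_semidegree D0 by eexists.
have [Mc McE] : exists Mc, Mc = 3 * (2 * K0 - 1) by eexists.
rewrite -dE in deg; rewrite -kE.
have k0 : 0 < k by rewrite kE muln_gt0 kap0.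
have Knk : K1 * k <= n by rewrite kE mulnA.
have nKk : n <= 2 * (K1 * k) by rewrite kE (mulnA K1).
have ku : 5 * (Mc * (10 * q) + 10 * q) + q = k.
  by rewrite kE kapE -McE; ring.
have dk : 14 * (a * k) <= d.
  rewrite -(leq_pmul2l a0); apply: leq_trans deg; apply: leq_trans Knk.
  by rewrite K1E; apply: eq_leq; ring.
have ak : k <= a * k by rewrite leq_pmull.
have nK : k * 14 <= n.
  by apply: leq_trans Knk; rewrite mulnC leq_mul2r K1E leq_pmulr ?muln_gt0 ?a0 ?orbT.
have qk : q <= k by rewrite kE leq_pmull.
apply: (@pseudorandom_cycles n D0 G d k h (128 * K1 * K1 * h) _ K0
  (Mc * (10 * q)) (10 * q) q (7 * k) (5 * (Mc * (10 * q) + 10 * q) + 1)) => //.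
- by rewrite muln_gt0.
- rewrite (mulnS k); apply: leq_ltn_trans (_ : k * (128 * K1 * K1 * h) < _); last by lia.
  have := leq_mul (leqnn (64 * K1 * h)) nKk.
  have -> : 64 * K1 * h * (2 * (K1 * k)) = k * (128 * K1 * K1 * h) by ring.
  by move=> hh; apply: leq_trans hh; apply: eq_leq; ring.
- have := leq_mul nKk (leqnn (128 * K1 * K1 * h * (128 * K1 * K1 * h))).
  move/leq_trans; apply; apply: eq_leq; rewrite K0E; ring.
- by lia.
- by lia.
- by lia.
- by lia.
- rewrite -(leq_pmul2l (_ : 0 < a * a)) ?muln_gt0 ?a0 //.
  have := leq_mul deg deg.
  have -> : a * d * (a * d) = a * a * (d * d) by ring.
  move=> hh; apply: leq_trans hh.
  have := leq_mul (leqnn n) Knk.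
  by move=> hh; apply: leq_trans hh; apply: eq_leq; rewrite K1E; ring.
- by lia.
- by lia.
- rewrite McE; apply: potential_bound => //.
  apply: leq_trans (cube_le_pow q); rewrite mulnCA leq_mul2l /= leq_mul2r.
  apply/orP; right; apply: leq_trans nhi _.
  by rewrite mulnA leq_mul2r Kq orbT.
- by lia.
Qed.

(** * The random digraph *)

Import Order.TTheory GRing.Theory Num.Theory.

Local Open Scope ring_scope.

Section RandomDigraph.
Variables (R : realType) (n : nat) (p : R).
Implicit Types (D : digraph 'I_n) (F : {set 'I_n * 'I_n}).

Lemma edges_offdiag D e : e \in edges D -> e.1 != e.2.
Proof.
case: e => u v /= uv; apply: contraTneq uv => ->.
exact: (forallP (edges_loopless D)).
Qed.

Lemma mean_prod (x : 'I_n * 'I_n -> R) :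
  \sum_D Dnp_mass p D * \prod_(e in edges D) x e =
  \prod_(e | e.1 != e.2) (p * x e + (1 - p)).
Proof.
pose f (e : 'I_n * 'I_n) : R := if e.1 != e.2 then p * x e else 0.
pose g (e : 'I_n * 'I_n) : R := if e.1 != e.2 then 1 - p else 1.
transitivity (\prod_e (f e + g e)); last first.
  rewrite [RHS]big_mkcond; apply: eq_bigr => e _.
  by rewrite /f /g; case: ifP; rewrite ?add0r.
rewrite bigA_distr (bigID (@loopless _)) /= [X in _ = _ + X]big1 ?addr0; last first.
  move=> E; rewrite negb_forall => /existsP[v]; rewrite negbK => vE.
  by rewrite (bigD1 (v, v)) //= vE /f eqxx mul0r.
rewrite [RHS](reindex_omap (fun D : digraph 'I_n => edges D) insub) /=; last first.
  by move=> E hE; rewrite insubT.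
apply: eq_big => [D|D _]; first by rewrite edges_loopless valK eqxx.
rewrite /Dnp_mass big_mkcond [X in _ * X]big_mkcond -big_split /=.
apply: eq_bigr => e _; rewrite /f /g.
have [eD|] := boolP (e \in edges D); last by rewrite mulr1; case: ifP.
by rewrite (edges_offdiag eD).
Qed.

Lemma mean_exp F (y : R) : {in F, forall e, e.1 != e.2} ->
  \sum_D Dnp_mass p D * y ^+ #|edges D :&: F| = (p * y + (1 - p)) ^+ #|F|.
Proof.
move=> offF; have := mean_prod (fun e => if e \in F then y else 1).
rewrite (eq_bigr (fun D => Dnp_mass p D * y ^+ #|edges D :&: F|)) => [->|D _].
  rewrite (bigID (mem F)) /= [X in _ * X]big1 => [|e /andP[_ /negbTE->]]; last by lra.
  rewrite mulr1 (eq_bigr (fun=> p * y + (1 - p))) => [|e /andP[_ ->] //].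
  rewrite (eq_bigl (mem F)) ?prodr_const // => e.
  by rewrite andb_idl // => /offF.
congr (_ * _); rewrite -big_mkcondr /= prodr_const; congr (_ ^+ _).
by apply: eq_card => e; rewrite !inE.
Qed.

Lemma prob_ge (A : pred (digraph 'I_n)) (X : digraph 'I_n -> R) :
    0 <= p <= 1 -> (forall D, 0 <= X D) -> (forall D, ~~ A D -> 1 <= X D) ->
  1 - \sum_D Dnp_mass p D * X D <= Dnp_prob p A.
Proof.
move=> p01 X0 X1; rewrite lerBlDr -(Dnp_mass_sum1 n p) (bigID A) /=.
rewrite lerD2l big_mkcond /= ler_sum // => D _; have m0 := Dnp_mass_ge0 D p01.
by case: ifP => [/X1|_]; [rewrite -{1}[Dnp_mass p D]mulr1; apply: ler_wpM2l | rewrite mulr_ge0].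
Qed.

Definition spread_defect k t D : R :=
  \sum_(AB | kpair k AB) 2 ^+ t * 2^-1 ^+ #|edges D :&: setX AB.1 AB.2|.

Lemma spread_defect_ge0 k t D : 0 <= spread_defect k t D.
Proof. by apply: sumr_ge0 => AB _; rewrite mulr_ge0 ?exprn_ge0 ?invr_ge0. Qed.

Lemma spread_defect_ge1 k t D : ~~ spread k t D -> 1 <= spread_defect k t D.
Proof.
rewrite negb_forall => /existsP[AB]; rewrite negb_imply -ltnNge => /andP[kAB lt].
rewrite /spread_defect (bigD1 AB) //= ler_wpDr //.
  by apply: sumr_ge0 => AB' _; rewrite mulr_ge0 ?exprn_ge0 ?invr_ge0.
rewrite -(subnK (ltnW lt)) exprD -mulrA -exprMn divff ?pnatr_eq0 // expr1n mulr1.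
by rewrite exprn_ege1 // ler1n.
Qed.

Lemma mean_spread_defect k t : 0 <= p <= 1 ->
  \sum_D Dnp_mass p D * spread_defect k t D <=
  4 ^+ n * 2 ^+ t * (1 - p / 2) ^+ (k * k).
Proof.
move=> /andP[p0 p1]; have q0 : 0 <= 1 - p / 2 by lra.
under eq_bigr do rewrite mulr_sumr.
rewrite exchange_big /=.
rewrite (eq_bigr (fun=> 2 ^+ t * (1 - p / 2) ^+ (k * k))) => [|AB /and3P[dAB /eqP cA /eqP cB]].
  rewrite sumr_const -[_ *+ #|_|]mulr_natl -[X in _ <= X]mulrA ler_wpM2r ?mulr_ge0 ?exprn_ge0 //.
  rewrite -natrX ler_nat (leq_trans (max_card _)) // card_prod -!cardsT -powersetT.
  by rewrite card_powerset cardsT card_ord -expnMn.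
under eq_bigr do rewrite mulrCA.
rewrite -mulr_sumr mean_exp; last first.
  move=> [a b]; rewrite inE /= => /andP[aA bB]; apply: contraTneq aA => ->.
  by rewrite (disjointFl dAB bB).
by rewrite cardsX cA cB; congr (_ * _ ^+ _); lra.
Qed.

Lemma mean_two_pow : \sum_(D : digraph 'I_n) Dnp_mass p D * 2 ^+ #|edges D| =
  (1 + p) ^+ #|[set e : 'I_n * 'I_n | e.1 != e.2]|.
Proof.
have -> : 1 + p = p * 2 + (1 - p) by lra.
rewrite -mean_exp => [|e]; last by rewrite inE.
apply: eq_bigr => D _; congr (_ * _ ^+ _); apply: eq_card => e; rewrite !inE.
by apply/idP/andP => [eD|[] //]; rewrite eD (edges_offdiag eD).
Qed.

Lemma prob_pseudorandom k t q M D0 : 0 <= p <= 1 ->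
  1 - (4 ^+ n * 2 ^+ t * (1 - p / 2) ^+ (k * k) + 4 ^+ n * 2 * (1 - p / 2) ^+ (q * q) +
       2^-1 ^+ M * (1 + p) ^+ (n * n) + (1 - p) ^+ #|edges D0|)
    <= Dnp_prob p (pseudorandom k t q M D0).
Proof.
move=> p01; have /andP[p0 p1] := p01.
pose X D := spread_defect k t D + spread_defect q 1 D + 2^-1 ^+ M * 2 ^+ #|edges D| +
  0 ^+ #|edges D :&: reverse D0| : R.
have h0 D : 0 <= (2^-1 : R) ^+ M * 2 ^+ #|edges D| by rewrite mulr_ge0 ?exprn_ge0 ?invr_ge0.
have z0 D : 0 <= (0 : R) ^+ #|edges D :&: reverse D0| by rewrite exprn_ge0.
have s1 D := spread_defect_ge0 k t D; have s2 D := spread_defect_ge0 q 1 D.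
apply: le_trans (prob_ge (X := X) p01 _ _); last first.
- move=> D; rewrite /X; rewrite !negb_and => /or4P[/spread_defect_ge1 h|/spread_defect_ge1 h|h|h].
  + by have := s2 D; have := h0 D; have := z0 D; lra.
  + by have := s1 D; have := h0 D; have := z0 D; lra.
  + rewrite -ltnNge in h.
    have : 1 <= (2^-1 : R) ^+ M * 2 ^+ #|edges D|.
      rewrite -(subnK (ltnW h)) exprD mulrCA -exprMn mulVf ?pnatr_eq0 // expr1n mulr1.
      by rewrite exprn_ege1 // ler1n.
    by have := s1 D; have := s2 D; have := z0 D; lra.
  + rewrite negbK in h; rewrite (eqP h) cards0 expr0.
    by have := s1 D; have := s2 D; have := h0 D; lra.
- by move=> D; rewrite !addr_ge0.
rewrite lerB // /X.
under eq_bigr do rewrite !mulrDr.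
rewrite !big_split /= !lerD ?mean_spread_defect //.
- under eq_bigr do rewrite mulrCA.
  rewrite -mulr_sumr mean_two_pow ler_wpM2l ?exprn_ge0 ?invr_ge0 //.
  rewrite ler_weXn2l //; first by lra.
  by rewrite (leq_trans (max_card _)) // card_prod card_ord.
- rewrite mean_exp => [|[a b]]; last by rewrite inE => /edges_offdiag /=; rewrite eq_sym.
  rewrite mulr0 add0r le_eqVlt; apply/orP; left; apply/eqP; congr (_ ^+ _).
  rewrite -(card_imset (edges D0) (f := fun e => (e.2, e.1))); last by move=> [? ?] [? ?] [-> ->].
  apply: eq_card => -[a b]; rewrite inE; apply/idP/imsetP => [h|[[c d] h [-> ->]] //].
  by exists (b, a).
Qed.

End RandomDigraph.

Section ExpBounds.
Variable R : realType.
Implicit Types (x : R) (n t N : nat).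

Lemma expX_le x y n : 0 <= x -> x <= expR y -> x ^+ n <= expR (n%:R * y).
Proof. by move=> x0 xy; rewrite expRM_natl lerXn2r // nnegrE expR_ge0. Qed.

Lemma two_le_expR1 : (2 : R) <= expR 1.
Proof. by have := expR_ge1Dx (1 : R); lra. Qed.

Lemma exp_bound n t N x : 0 <= x <= 1 ->
  4 ^+ n * 2 ^+ t * (1 - x) ^+ N <= expR (2 * n%:R + t%:R - N%:R * x).
Proof.
move=> /andP[x0 x1].
rewrite -[4](_ : (2 : R) ^+ 2 = _); last by rewrite -natrX.
rewrite -exprM !expRD; apply: ler_pM; rewrite ?mulr_ge0 ?exprn_ge0 ?subr_ge0 //.
  apply: ler_pM; rewrite ?exprn_ge0 //.
    by have := expX_le (2 * n) (ler0n R 2) two_le_expR1; rewrite mulr1 natrM.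
  by have := expX_le t (ler0n R 2) two_le_expR1; rewrite mulr1.
rewrite -mulrN; apply: expX_le; first by lra.
by have := expR_ge1Dx (- x).
Qed.

Lemma half_pow_bound M N x : 0 <= x ->
  2^-1 ^+ M * (1 + x) ^+ N <= expR (N%:R * x - M%:R / 2).
Proof.
move=> x0; rewrite expRD mulrC ler_pM ?exprn_ge0 ?invr_ge0 //; first by lra.
  by apply: expX_le; [lra | apply: expR_ge1Dx].
rewrite -mulrN; apply: expX_le; rewrite ?invr_ge0 //.
by have := expR_ge1Dx (- 2^-1 : R); lra.
Qed.

Lemma expRN_small (n : nat) (eps : R) : 0 < eps -> 8 <= eps * n%:R ->
  4 * expR (- (n%:R / 2)) <= eps.
Proof.
move=> e0 en; rewrite expRN -[eps]mulr1.
have := expR_ge1Dx (n%:R / 2 : R); set E := expR _ => hE.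
have n0 : 0 <= n%:R :> R by [].
have E0 : 0 < E by rewrite expR_gt0.
rewrite ler_pdivrMr // mulr1; nra.
Qed.

Lemma monotone_prob n (p : R) (A B : pred (digraph 'I_n)) : 0 <= p <= 1 ->
  (forall D, A D -> B D) -> Dnp_prob p A <= Dnp_prob p B.
Proof.
move=> p01 AB; rewrite /Dnp_prob big_mkcond [X in _ <= X]big_mkcond ler_sum // => D _.
have := Dnp_mass_ge0 D p01; case: ifP => [/AB->|_] //.
by case: ifP.
Qed.

End ExpBounds.

Theorem theorem1p3 (R : realType) (alpha : R) (halpha : 0 < alpha) :
  exists2 C : R, 0 < C &
    forall eps : R, 0 < eps ->
      exists N : nat, forall n : nat, (N <= n)%N ->
        forall D0 : digraph 'I_n, alpha * n%:R <= (min_semidegree D0)%:R ->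
          1 - eps <= Dnp_prob (C / n%:R)
            (fun D => contains_all_cycle_orientations (dunion D0 D)).
Proof.
have [a a0 aalpha] : exists2 a, (0 < a)%N & 1 <= a%:R * alpha.
  exists (Num.truncn alpha^-1).+1 => //.
  by rewrite -ler_pdivrMr // mul1r ltW // truncnS_gt.
have [K1 [kap [h [aK kap0 hK cyc]]]] := perturbed_cycles a0.
have K10 : (0 < K1)%N by apply: leq_trans aK.
have h0 : (0 < h)%N by apply: leq_trans hK; rewrite !muln_gt0 K10 kap0.
exists (8 * K1 * h)%:R; first by rewrite ltr0n !muln_gt0 K10 h0.
move=> eps eps0; pose K := (K1 * kap)%N.
have K0 : (0 < K)%N by rewrite muln_gt0 K10 kap0.
exists (K * (2 * K) + 8 * K1 * h + (Num.truncn (8 / eps)).+1 + 2)%N => n Nn D0 deg.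
have n0 : (0 < n)%N by lia.
have nR : 0 < n%:R :> R by rewrite ltr0n.
set C := (8 * K1 * h)%N; set p : R := C%:R / n%:R.
have p01 : 0 <= p <= 1.
  rewrite divr_ge0 //= ler_pdivrMr // mul1r ler_nat; lia.
have [p0 p1] := andP p01.
have degn : (n <= a * min_semidegree D0)%N.
  rewrite -(ler_nat R) natrM; apply: le_trans (_ : a%:R * (alpha * n%:R) <= _).
    by rewrite mulrA -{1}[n%:R]mul1r ler_wpM2r.
  by rewrite ler_wpM2l.
pose q := (n %/ K)%N.
have nlo : (K * q <= n)%N by rewrite mulnC leq_divM.
have Kq : (2 * K <= q)%N by rewrite leq_divRL //; lia.
have q0 : (0 < q)%N by apply: leq_trans Kq; rewrite muln_gt0.
have nhi : (n <= 2 * (K * q))%N.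
  have := ltn_ceil n K0; have : (K <= K * q)%N by rewrite leq_pmulr.
  rewrite -/q mulSn [(q * K)%N]mulnC mul2n -addnn => h1 /ltnW h2.
  by rewrite (leq_trans h2) // leq_add2r.
apply: le_trans (monotone_prob p01 (fun G => cyc q n Kq nlo nhi D0 G degn)).
apply: le_trans (prob_pseudorandom _ _ _ _ D0 p01).
rewrite lerD2l lerN2.
have e8 : 8 <= eps * n%:R.
  rewrite mulrC -ler_pdivrMr //; apply: le_trans (ltW (truncnS_gt _)) _.
  by rewrite ler_nat; apply: leq_trans Nn; apply: leq_trans (leq_addr _ _); apply: leq_addl.
apply: le_trans (expRN_small eps0 e8).
have [k kE] : exists k, k = (kap * q)%N by eexists.
rewrite -kE; set M := (32 * K1 * h * n)%N; set E := expR _.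
have np : n%:R * p = C%:R by rewrite /p mulrC divfK ?gt_eqF.
have nk : (n <= 2 * K1 * k)%N by rewrite (leq_trans nhi) // kE /K !mulnA.
have hK1 : (5 * K1 <= h)%N by apply: leq_trans hK; rewrite leq_pmulr // muln_gt0 kap0.
have p2 : 0 <= p / 2 <= 1 by lra.
have pk : 4 * h%:R <= p * k%:R.
  have K1R : 0 < K1%:R :> R by rewrite ltr0n.
  rewrite -(ler_pM2l K1R) -(ler_pM2l (_ : 0 < 2 :> R)) //.
  have : p * n%:R <= p * (2 * K1 * k)%:R by rewrite ler_wpM2l // ler_nat.
  by rewrite [p * n%:R]mulrC np /C !natrM; lra.
have hk : 5 * n%:R <= 2 * (k%:R * h%:R) :> R.
  rewrite -!natrM ler_nat; apply: leq_trans (leq_mul (leqnn 5) nk) _.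
  have -> : (5 * (2 * K1 * k) = 2 * (k * (5 * K1)))%N by ring.
  by rewrite !leq_mul.
have b1 : 4 ^+ n * 2 ^+ (k * h) * (1 - p / 2) ^+ (k * k) <= E.
  apply: le_trans (exp_bound _ _ _ p2) _; rewrite ler_expR !natrM.
  have : k%:R * (4 * h%:R) <= k%:R * (p * k%:R) by rewrite ler_wpM2l.
  by move: hk; lra.
have b2 : 4 ^+ n * 2 * (1 - p / 2) ^+ (q * q) <= E.
  have -> : 2 = 2 ^+ 1 :> R by [].
  apply: le_trans (exp_bound _ _ _ p2) _; rewrite ler_expR !natrM.
  have kapR : 0 < kap%:R :> R by rewrite ltr0n.
  have pq : 20 * K%:R <= p * q%:R.
    rewrite -(ler_pM2l kapR); have : (5 * K1 * (kap * kap))%:R <= h%:R :> R by rewrite ler_nat.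
    by move: pk; rewrite kE /K !natrM; lra.
  have : q%:R * (20 * K%:R) <= q%:R * (p * q%:R) by rewrite ler_wpM2l.
  have : n%:R <= 2 * (K%:R * q%:R) :> R by rewrite -!natrM ler_nat.
  have : 1 <= n%:R :> R by rewrite ler1n.
  by lra.
have b3 : 2^-1 ^+ M * (1 + p) ^+ (n * n) <= E.
  apply: le_trans (half_pow_bound _ _ p0) _; rewrite ler_expR.
  rewrite natrM -mulrA np.
  have -> : M%:R = 4 * (n%:R * C%:R) :> R by rewrite -!natrM; congr _%:R; rewrite /M /C; ring.
  have : n%:R * 1 <= n%:R * C%:R :> R.
    by rewrite ler_wpM2l // ler1n !muln_gt0 K10 h0.
  by move: nR; lra.
have b4 : (1 - p) ^+ #|edges D0| <= E.
  have := exp_bound 0 0 #|edges D0| p01; rewrite !expr0 !mul1r => /le_trans; apply.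
  rewrite ler_expR.
  have : (n * min_semidegree D0)%:R * p <= #|edges D0|%:R * p.
    by rewrite ler_wpM2r // ler_nat -{1}(card_ord n) edges_ge.
  rewrite natrM mulrAC np -natrM.
  have : n%:R <= (C * min_semidegree D0)%:R :> R.
    rewrite ler_nat (leq_trans degn) // leq_mul2r (leq_trans aK) ?orbT //.
    by rewrite /C -mulnA mulnCA leq_pmulr // muln_gt0.
  by move: nR; lra.
lra.
Qed.
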